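(* Let $k=k_n$ be positive integers with $k=o(\log n)$. There is a choice of thresholds $\theta_n=(1+o(1))\sqrt{\frac{2\log n}{k}}$ such that, with probability tending to $1$ as $n\to\infty$, the greedy algorithm applied to the bipartite graph obtained by thresholding $\mathbf{C}^n$ at level $\theta_n$ produces a $k\times k$ submatrix of $\mathbf{C}^n$ all of whose entries are at least $\theta_n$.
   Context: $\mathbf{C}^n$ is an $n\times n$ matrix with i.i.d. standard normal entries, $[n]=\{1,\dots,n\}$. For a threshold $\theta$, the thresholded bipartite graph has left vertex set $[n]$ and right vertex set $[n]$, with an edge $i\sim j$ ($i$ on the left, $j$ on the right) if and only if $\mathbf{C}^n_{i,j}>\theta$. A pair $I,J\subset[n]$ is a clique if $i\sim j$ for all $i\in I$, $j\in J$. Greedy algorithm: pick the left node $i_1=1$ and let $J_1=\{j:1\sim j\}$. Pick any $j_1\in J_1$ and let $I_1=\{i\in[n]: i\sim j_1\}$. Pick any $i_2\in I_1$ different from $i_1$ and let $J_2=\{j\in J_1: i_2\sim j\}$. Pick any $j_2\in J_2$ different from $j_1$ and let $I_2=\{i\in I_1: i\sim j_2\}$, and so on, each time picking a node not chosen before. Repeat for as many steps as possible, ending on the right-hand side, so that the same number $m$ of nodes is chosen on the left and on the right. The chosen nodes form an $m\times m$ clique. The algorithm is said to produce a $k\times k$ submatrix if $m\ge k$, the submatrix being the one indexed by the first $k$ chosen rows and the first $k$ chosen columns. *)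

(* Defs.v *)
From HB Require Import structures.
From mathcomp Require Export all_boot all_order all_algebra.
From mathcomp Require Export all_classical all_reals all_analysis.

Set Implicit Arguments.
Unset Strict Implicit.
Unset Printing Implicit Defensive.

Import Order.TTheory GRing.Theory Num.Theory.
Import numFieldNormedType.Exports.

Local Open Scope classical_set_scope.
Local Open Scope ring_scope.

Definition mutually_independent d (T : measurableType d) (R : realType)
    (P : probability T R) (I : finType) (X : I -> {RV P >-> R}) : Prop :=
  forall (S : {set I}) (A : I -> set R),
    (forall i, measurable (A i)) ->
    P (\bigcap_(i in [set` S]) (X i @^-1` A i)) =
      (\prod_(i in S) P (X i @^-1` A i))%E.

Definition standard_normal d (T : measurableType d) (R : realType)
    (P : probability T R) (X : {RV P >-> R}) : Prop :=
  forall A : set R, measurable A -> distribution P X A = normal_prob 0 1 A.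

Definition iid_standard_normal d (T : measurableType d) (R : realType)
    (P : probability T R) (n : nat) (C : 'I_n -> 'I_n -> {RV P >-> R}) : Prop :=
  (forall i j, standard_normal (C i j)) /\
  mutually_independent (fun ij : 'I_n * 'I_n => C ij.1 ij.2).

Definition sample_matrix d (T : measurableType d) (R : realType)
    (P : probability T R) (n : nat) (C : 'I_n -> 'I_n -> {RV P >-> R})
    (w : T) : 'M[R]_n :=
  \matrix_(i, j) C i j w.

(** Bipartite graphs with both sides equal to ['I_n] are given by their edge
    relation, the first argument being the left vertex. *)

Definition threshold_graph (R : realType) (n : nat) (A : 'M[R]_n) (theta : R) :
  rel 'I_n := fun i j => theta < A i j.

(** [left_cand] and [right_cand] are the latest candidate sets of each side
    (everything, as long as the opposite side has no chosen node). *)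
Record greedy_state (n : nat) : Type := GreedyState {
  left_nodes : seq 'I_n;
  right_nodes : seq 'I_n;
  left_cand : {set 'I_n};
  right_cand : {set 'I_n}
}.

Section Greedy.
Variables (n : nat) (E : rel 'I_n).
Implicit Type s : greedy_state n.

Definition greedy_start : greedy_state n :=
  GreedyState [::] [::] [set: 'I_n] [set: 'I_n].

(** The sides alternate, left first. The vertex 1 of the left side is the
    ordinal of value 0, and it is the only possible first pick. *)
Definition left_pick s (i : 'I_n) : bool :=
  [&& size (left_nodes s) == size (right_nodes s),
      i \in left_cand s, i \notin left_nodes s
    & (left_nodes s == [::]) ==> (val i == 0%N)].

Definition right_pick s (j : 'I_n) : bool :=
  [&& size (left_nodes s) == (size (right_nodes s)).+1,
      j \in right_cand s & j \notin right_nodes s].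

Definition add_left s (i : 'I_n) : greedy_state n :=
  GreedyState (rcons (left_nodes s) i) (right_nodes s)
    (left_cand s) [set j in right_cand s | E i j].

Definition add_right s (j : 'I_n) : greedy_state n :=
  GreedyState (left_nodes s) (rcons (right_nodes s) j)
    [set i in left_cand s | E i j] (right_cand s).

Inductive greedy_reachable : greedy_state n -> Prop :=
| Reachable_start : greedy_reachable greedy_start
| Reachable_left s i :
    greedy_reachable s -> left_pick s i -> greedy_reachable (add_left s i)
| Reachable_right s j :
    greedy_reachable s -> right_pick s j -> greedy_reachable (add_right s j).

Definition greedy_stuck s : Prop :=
  forall x : 'I_n, ~~ left_pick s x /\ ~~ right_pick s x.

(** Final states of the runs, one for each sequence of admissible picks. In a
    final state the left side may have one extra node, which could not be
    matched on the right; it is not part of the output. *)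
Definition greedy_final s : Prop := greedy_reachable s /\ greedy_stuck s.

Definition output_size s : nat := size (right_nodes s).

End Greedy.

(** Since the algorithm allows any admissible pick, this quantifies over all
    the runs. *)
Definition greedy_succeeds (R : realType) (n : nat) (A : 'M[R]_n) (theta : R)
    (k : nat) : Prop :=
  forall s : greedy_state n, greedy_final (threshold_graph A theta) s ->
    (k <= output_size s)%N /\
    (forall i j, i \in take k (left_nodes s) -> j \in take k (right_nodes s) ->
       theta <= A i j).

(* Main.v *)
(** Take theta = (1 - 9 sqrt(k / log n)) sqrt(2 log n / k). A run that stops
    before k rounds exhibits at most k vertices of one side whose common
    neighbors are all among at most k vertices of the other side. Whatever the
    picks are, this is excluded as soon as no pair of k-tuples (u, v) is such
    that v contains all the common neighbors of u. For given u and v that event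
    has probability at most (1 - p^k)^(n - k), where p is the probability of an
    edge, and there are n^(2k) pairs for each side. With y = sqrt(k log n), the
    crude bound p >= exp(- (theta + 1)^2 / 2 - 2) gives n p^k >= exp(4 y), which
    dominates log (n^(2k)) = 2 y^2, so the union bound suffices. *)

Require Import Defs.
From mathcomp Require Import all_boot all_order all_algebra.
From mathcomp Require Import all_classical all_reals all_analysis.
From mathcomp Require Import measurable_realfun lra ring.
Import Order.TTheory GRing.Theory Num.Theory.
Import numFieldNormedType.Exports.
Local Open Scope classical_set_scope.
Local Open Scope ring_scope.

(** * Deterministic analysis of the greedy runs *)

(** Each pick is taken from the candidate set of its side, whose members are adjacent to every node
    already chosen opposite, so every pick extends the clique. *)
Lemma greedy_invariant (n : nat) (E : rel 'I_n) (s : greedy_state n) :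
  greedy_reachable E s ->
  [/\ (size (right_nodes s) <= size (left_nodes s) <= (size (right_nodes s)).+1)%N,
      left_cand s = finset (fun i => all (E i) (right_nodes s)),
      right_cand s = finset (fun j => all (E^~ j) (left_nodes s)) &
      forall i j, i \in left_nodes s -> j \in right_nodes s -> E i j].
Proof.
elim => {s} [|s i _ [/andP[sz1 sz2] lc rc edge]|s j _ [/andP[sz1 sz2] lc rc edge]].
- by split=> //=; apply/setP => x; rewrite !inE.
- case/and4P=> /eqP szE iL _ _; split=> /=.
  + by rewrite size_rcons szE leqnSn leqnn.
  + exact: lc.
  + by apply/setP => x; rewrite rc !inE all_rcons andbC.
  + move=> x y; rewrite mem_rcons inE => /predU1P[->|xl] yr; last exact: edge.
    by move: iL; rewrite lc inE => /allP; apply.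
- case/and3P=> /eqP szE jR _; split=> /=.
  + by rewrite size_rcons szE leqnSn leqnn.
  + by apply/setP => x; rewrite lc !inE all_rcons andbC.
  + exact: rc.
  + move=> x y xl; rewrite mem_rcons inE => /predU1P[->|yr]; last exact: edge.
    by move: jR; rewrite rc inE => /allP; apply.
Qed.

(** Padding lets runs stopped at different lengths be counted by [k]-tuples alone. It is harmless
    because enlarging [s] or [t] preserves [common_nbrs_sub] below. *)
Lemma subset_tuple (T : eqType) (x0 : T) (k : nat) (l : seq T) :
  (size l <= k)%N -> exists t : k.-tuple T, {subset l <= t}.
Proof.
move=> lk; have szt : size (l ++ nseq (k - size l) x0) == k.
  by rewrite size_cat size_nseq subnKC.
by exists (Tuple szt) => x xl; rewrite mem_cat xl.
Qed.

(** The contrapositive form separates the vertices [j] outside [t]: the conditions for distinct [j]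
    concern disjoint sets of entries, hence independent events. *)
Definition common_nbrs_sub (n k : nat) (E : rel 'I_n) (s t : k.-tuple 'I_n) :=
  forall j, j \notin t -> exists2 i, i \in s & ~~ E i j.

(** A stuck state with equal sizes has no left pick, so all common neighbors of the right nodes are
    already chosen. When the left side is one ahead, the same holds with the sides exchanged. *)
Lemma greedy_outputs (n k : nat) (E : rel 'I_n) (s : greedy_state n) :
  (0 < n)%N ->
  (forall u v : k.-tuple 'I_n, ~ common_nbrs_sub n k E u v) ->
  (forall u v : k.-tuple 'I_n, ~ common_nbrs_sub n k (fun j i => E i j) u v) ->
  greedy_final E s -> (k <= output_size s)%N.
Proof.
move=> n_gt0 Eright Eleft [/greedy_invariant[/andP[sz1 sz2] lc rc _] stuck].
rewrite leqNgt; apply/negP => lt_k; rewrite /output_size in lt_k.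
have x0 : 'I_n := Ordinal n_gt0.
have [szE|szN] := eqVneq (size (left_nodes s)) (size (right_nodes s)).
  (* The first pick is restricted to vertex 1, so the empty state is treated apart: [n > 0] makes
     that vertex available. *)
  have [l0|lN0] := eqVneq (left_nodes s) [::].
    have [/negP + _] := stuck (Ordinal n_gt0); apply.
    have r0 : right_nodes s = [::] by apply: size0nil; rewrite -szE l0.
    by rewrite /left_pick l0 lc r0 inE.
  have [|u su] := @subset_tuple _ x0 k (right_nodes s); first exact: ltnW.
  have [|v sv] := @subset_tuple _ x0 k (left_nodes s).
    by rewrite szE ltnW.
  apply: (Eleft u v) => i iv; apply: contrapT => Ei.
  have [/negP + _] := stuck i; apply.
  rewrite /left_pick szE eqxx (negbTE lN0) /= andbT lc inE.
  rewrite (contra (sv i) iv) andbT; apply/allP => j jr.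
  by apply/negPn/negP => nE; apply: Ei; exists j => //; exact: su.
have szE : size (left_nodes s) = (size (right_nodes s)).+1.
  by apply/eqP; rewrite eqn_leq sz2 ltn_neqAle eq_sym szN.
(* The extra left node still fits in a [k]-tuple, since fewer than [k] right nodes are chosen. *)
have [|u su] := @subset_tuple _ x0 k (left_nodes s); first by rewrite szE.
have [|v sv] := @subset_tuple _ x0 k (right_nodes s); first exact: ltnW.
apply: (Eright u v) => j jv; apply: contrapT => Ej.
have [_ /negP] := stuck j; apply.
rewrite /right_pick szE eqxx /= rc inE (contra (sv j) jv) andbT.
apply/allP => i il.
by apply/negPn/negP => nE; apply: Ej; exists i => //; exact: su.
Qed.

Lemma greedy_clique (n : nat) (E : rel 'I_n) (s : greedy_state n) (i j : 'I_n) :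
  greedy_final E s -> i \in left_nodes s -> j \in right_nodes s -> E i j.
Proof. by case=> /greedy_invariant[_ _ _ edge] _; exact: edge. Qed.

(** * Measurability, independence and the union bound *)

(** The event is a finite union, over the accepted truth tables, of finite intersections. This gives
    measurability of events that quantify over tuples or over all runs, as they depend only on the
    table of edges. *)
Lemma measurable_finite_pred d (T : measurableType d) (U : finType)
    (G : U -> set T) (Q : set {ffun U -> bool}) :
  (forall u, measurable (G u)) ->
  measurable [set w | Q [ffun u => `[< G u w >]]].
Proof.
move=> mG.
rewrite [X in measurable X](_ : _ = \bigcup_(g in Q) \bigcap_(u in [set: U])
    (if g u then G u else ~` G u)); last first.
  apply/seteqP; split=> w /=.
    move=> Qw; exists [ffun u => `[< G u w >]] => // u _.
    by rewrite ffunE; case: asboolP.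
  case=> g Qg gw; rewrite (_ : [ffun u => _] = g)//; apply/ffunP => u.
  rewrite ffunE; have := gw u I; case: (g u) => ?; first exact/asboolP.
  exact/asboolPn.
apply: fin_bigcup_measurable; first exact: finite_finset.
move=> g _; apply: fin_bigcap_measurable; first exact: finite_finset.
by move=> u _; case: (g u) => //; exact: measurableC.
Qed.

Lemma measurable_forall_in d (T : measurableType d) (U : finType)
    (G : U -> set T) (D : {set U}) :
  (forall u, measurable (G u)) -> measurable [set w | forall u, u \in D -> G u w].
Proof.
move=> mG; rewrite (_ : mkset _ = \bigcap_(u in [set` D]) G u); last first.
  by apply/seteqP; split.
by apply: fin_bigcap_measurable => //; exact: finite_finpred.
Qed.

(* Removing one event at a time: [P (A `\` F j) = P A - P (A `&` F j)]. *)
Lemma independent_setC d (T : measurableType d) (R : realType)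
    (P : probability T R) (U : finType) (F : U -> set T) (q : R) :
  (forall u, measurable (F u)) ->
  (forall D : {set U}, P [set w | forall u, u \in D -> F u w] = (q ^+ #|D|)%:E) ->
  forall D : {set U}, P [set w | forall u, u \in D -> ~ F u w] =
    ((1 - q) ^+ #|D|)%:E.
Proof.
move=> mF PF D.
(* The induction needs a second set [D1] of events required to hold, because the term [P (A & F x)]
   moves [x] from the excluded events to the required ones. *)
suff H : forall D1 : {set U}, [disjoint D1 & D]%B ->
    P [set w | (forall u, u \in D1 -> F u w) /\ (forall u, u \in D -> ~ F u w)]
    = (q ^+ #|D1| * (1 - q) ^+ #|D|)%:E.
  have := H finset.set0; rewrite cards0 mul1r => <-.
    congr (P _); apply/seteqP; split => w /=; last by case.
    by move=> ?; split=> // u; rewrite inE.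
  by rewrite -setI_eq0 finset.set0I.
have [m] := ubnP #|D|; elim: m D => // m IH D Dm D1 dis.
have [->|[x xD]] := set_0Vmem D.
  rewrite cards0 mulr1 -PF; congr (P _); apply/seteqP; split => w /=; first by case.
  by move=> ?; split=> // u; rewrite inE.
pose D' := D :\ x.
have xD1 : x \notin D1 by apply/negP => /(disjointFr dis); rewrite xD.
have cD : #|D| = #|D'|.+1 by rewrite (cardsD1 x) xD.
have D'm : (#|D'| < m)%N by move: Dm; rewrite cD.
have disD' : [disjoint D1 & D']%B by apply: disjointWr dis; exact: subsetDl.
have disD1 : [disjoint x |: D1 & D']%B.
  rewrite disjoint_subset; apply/fintype.subsetP => u.
  case/setU1P => [->|uD1]; first by rewrite !inE eqxx.
  by rewrite inE (disjointFr disD' uD1).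
have mA E1 E2 : measurable [set w | (forall u, u \in (E1 : {set U}) -> F u w) /\
    (forall u, u \in (E2 : {set U}) -> ~ F u w)].
  rewrite (_ : mkset _ = [set w | forall u, u \in E1 -> F u w] `&`
     [set w | forall u, u \in E2 -> (~` F u) w]) //.
  by apply: measurableI; apply: measurable_forall_in => // u; exact: measurableC.
have PD A B : measurable A -> measurable B ->
    P (A `\` B) = (P A - P (A `&` B))%E.
  move=> ? ?; apply: measureD => //.
  by apply: le_lt_trans (probability_le1 P _) _; rewrite ?ltry.
rewrite (_ : mkset _ = [set w | (forall u, u \in D1 -> F u w) /\
   (forall u, u \in D' -> ~ F u w)] `\` F x); last first.
  apply/seteqP; split=> w /=.
    case=> h1 h2; split; last exact: h2.
    by split=> // u /setD1P[_]; exact: h2.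
  case=> -[h1 h2 nx]; split=> // u uD.
  by have [->//|ux] := eqVneq u x; apply: h2; rewrite !inE ux.
rewrite PD//.
rewrite [X in (_ - P X)%E](_ : _ = [set w | (forall u, u \in x |: D1 -> F u w) /\
   (forall u, u \in D' -> ~ F u w)]); last first.
  apply/seteqP; split=> w /=.
    by case=> -[h1 h2 hx]; split=> // u /setU1P[->//|]; exact: h1.
  case=> h1 h2; split; last by apply: h1; rewrite setU11.
  by split=> // u uD; apply: h1; rewrite inE uD orbT.
rewrite !IH// -EFinB cardsU1 xD1 cD add1n !exprS; congr (_%:E).
by ring.
Qed.

Lemma measure_bigsetU_le d (T : measurableType d) (R : realType)
    (P : {measure set T -> \bar R}) (I : Type) (r : seq I) (F : I -> set T) :
  (forall i, measurable (F i)) ->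
  (P (\big[setU/set0]_(i <- r) F i) <= \sum_(i <- r) P (F i))%E.
Proof.
move=> mF; elim: r => [|x r IH]; first by rewrite !big_nil measure0.
rewrite !big_cons; apply: (le_trans (measureU2 _ _ _)) => //.
  by apply: bigsetU_measurable.
exact: leeD2l.
Qed.

(** The events that [j] is adjacent to all of [s] are independent over [j], of probability
    [p ^+ #|I|]; this follows from the rectangle hypothesis with [I] fixed. *)
Lemma common_nbrs_sub_prob d (T : measurableType d) (R : realType)
    (P : probability T R) (n k : nat) (e : 'I_n -> 'I_n -> set T) (p : R) :
  (forall i j, measurable (e i j)) -> 0 <= p <= 1 ->
  (forall I J : {set 'I_n},
     P [set w | forall i j, i \in I -> j \in J -> e i j w] =
       (p ^+ (#|I| * #|J|))%:E) ->
  forall s t : k.-tuple 'I_n,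
  (P [set w | common_nbrs_sub n k (fun i j => `[< e i j w >]) s t] <=
   ((1 - p ^+ k) ^+ (n - k))%:E)%E.
Proof.
move=> me /andP[p0 p1] Pe s t.
pose I : {set 'I_n} := finset (mem s); pose D : {set 'I_n} := finset (predC (mem t)).
pose F j : set T := [set w | forall i, i \in I -> e i j w].
rewrite (_ : mkset _ = [set w | forall j, j \in D -> ~ F j w]); last first.
  apply/seteqP; split=> w /= h j.
    rewrite inE => jt Fj; have [i si /asboolPn] := h _ jt; apply; apply: Fj.
    by rewrite inE.
  move=> jt; apply: contrapT => ne; apply: (h j); first by rewrite inE.
  move=> i; rewrite inE => si; apply: contrapT => ne'; apply: ne; exists i => //.
  exact/asboolPn.
rewrite (@independent_setC _ _ _ P _ F (p ^+ #|I|)); first last.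
- move=> J; rewrite -exprM -Pe; congr (P _).
  by apply/seteqP; split=> w /= h => [i j iI jJ|j jJ i iI]; exact: h.
- move=> j; exact: (@measurable_forall_in _ _ _ (fun i => e i j)).
have card_mem (u : k.-tuple 'I_n) : (#|finset (mem u)| <= k)%N.
  by rewrite cardsE -[leqRHS](size_tuple u) card_size.
have D_ge : (n - k <= #|D|)%N.
  rewrite leq_subLR (_ : D = ~: finset (mem t)); last by apply/setP => x; rewrite !inE.
  by rewrite -[leqLHS]card_ord -(cardsC (finset (mem t))) leq_add2r.
have q01 m : 0 <= p ^+ m <= 1 by rewrite exprn_ge0// exprn_ile1.
(* Tuples may repeat entries, so [#|I| <= k] and [#|D| >= n - k] are only inequalities; both go in
   the favorable direction. *)
rewrite lee_fin; apply: (@le_trans _ _ ((1 - p ^+ #|I|) ^+ (n - k))).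
  by apply: ler_wiXn2l => //; have := q01 #|I|; lra.
rewrite lerXn2r ?nnegrE ?subr_ge0 ?exprn_ile1// lerD2l lerN2.
by apply: ler_wiXn2l => //; exact: card_mem.
Qed.

Lemma ex_common_nbrs_sub_prob d (T : measurableType d) (R : realType)
    (P : probability T R) (n k : nat) (e : 'I_n -> 'I_n -> set T) (p : R) :
  (forall i j, measurable (e i j)) -> 0 <= p <= 1 ->
  (forall I J : {set 'I_n},
     P [set w | forall i j, i \in I -> j \in J -> e i j w] =
       (p ^+ (#|I| * #|J|))%:E) ->
  let A := [set w | exists u v : k.-tuple 'I_n,
              common_nbrs_sub n k (fun i j => `[< e i j w >]) u v] in
  measurable A /\
  (P A <= ((n ^ (2 * k))%:R * (1 - p ^+ k) ^+ (n - k))%:E)%E.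
Proof.
move=> me p01 Pe A.
pose B (uv : k.-tuple 'I_n * k.-tuple 'I_n) :=
  [set w | common_nbrs_sub n k (fun i j => `[< e i j w >]) uv.1 uv.2].
have mB uv : measurable (B uv).
  pose G (ij : 'I_n * 'I_n) := e ij.1 ij.2.
  have := @measurable_finite_pred _ T _ G
    [set g | common_nbrs_sub n k (fun i j => g (i, j)) uv.1 uv.2] _.
  rewrite (_ : mkset _ = B uv); first by apply; move=> ?; exact: me.
  apply/seteqP; split=> w /= h j jt; have [i si he] := h j jt; exists i => //.
    by move: he; rewrite ffunE.
  by rewrite ffunE.
have AE : A = \big[setU/set0]_uv B uv.
  rewrite -bigcup_seq; apply/seteqP; split=> w /=.
    by case=> u [v uv]; exists (u, v) => //=; rewrite mem_index_enum.
  by case=> -[u v] _ uv; exists u, v.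
split; first by rewrite AE; exact: bigsetU_measurable.
rewrite AE (le_trans (measure_bigsetU_le _ _ _ _ _ _ _ mB))//.
apply: (@le_trans _ _ (\sum_(uv : k.-tuple 'I_n * k.-tuple 'I_n)
    ((1 - p ^+ k) ^+ (n - k))%:E)%E).
  by apply: lee_sum => uv _; exact: common_nbrs_sub_prob.
rewrite sumEFin lee_fin big_const iter_addr_0 card_prod card_tuple card_ord.
rewrite -expnD addnn -mul2n.
by rewrite mulr_natl.
Qed.

(** Success contains the complement of two bad events, one for the graph and one for its transpose;
    hence the factor 2. *)
Lemma greedy_succeeds_prob d (T : measurableType d) (R : realType)
    (P : probability T R) (n k : nat) (C : 'I_n -> 'I_n -> {RV P >-> R})
    (theta p : R) :
  (0 < n)%N -> mutually_independent (fun ij : 'I_n * 'I_n => C ij.1 ij.2) ->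
  (forall i j, P (C i j @^-1` `]theta, +oo[) = p%:E) ->
  ((1 - ((n ^ (2 * k))%:R * (1 - p ^+ k) ^+ (n - k)) *+ 2)%:E <=
    P [set w | greedy_succeeds (sample_matrix C w) theta k] <= 1)%E.
Proof.
move=> n_gt0 indepC Cp.
pose e i j : set T := C i j @^-1` `]theta, +oo[.
have me i j : measurable (e i j).
  by rewrite /e; apply: measurable_funPTI; exact: measurable_itv.
have p01 : 0 <= p <= 1.
  have x := Ordinal n_gt0.
  rewrite -!lee_fin -(Cp x x); apply/andP; split; first exact: measure_ge0.
  by apply: probability_le1; exact: me.
have Pe (I J : {set 'I_n}) :
    P [set w | forall i j, i \in I -> j \in J -> e i j w] = (p ^+ (#|I| * #|J|))%:E.
  have := indepC (finset.setX I J) (fun=> `]theta, +oo[%classic)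
    (fun=> measurable_itv _).
  rewrite (eq_bigr (fun=> p%:E)) => [|ij _]; last exact: Cp.
  rewrite prodEFin prodr_const cardsX => <-; congr (P _).
  apply/seteqP; split => w /= h.
    by case=> i j /=; rewrite inE => /andP[]; exact: h.
  by move=> i j iI jJ; apply: (h (i, j)); rewrite /= inE iI.
have [mA PA] := ex_common_nbrs_sub_prob _ _ _ P n k e p me p01 Pe.
have [||mB PB] := ex_common_nbrs_sub_prob _ _ _ P n k (fun j i => e i j) p _ p01.
- by [].
- move=> J I; rewrite mulnC -Pe; congr (P _).
  by apply/seteqP; split => w /= h i j iI jJ; exact: h.
set A := mkset _ in mA PA; set B := mkset _ in mB PB.
have EE w : threshold_graph (sample_matrix C w) theta = (fun i j => `[< e i j w >]).
  apply/funext => i; apply/funext => j; rewrite /threshold_graph mxE /e.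
  by apply/idP/asboolP; rewrite /= in_itv/= andbT.
(* The condition on the entries is automatic, since the chosen nodes form a clique; only the output
   size remains. *)
set S := mkset _; have SE : S = [set w | forall s,
    greedy_final (fun i j => `[< e i j w >]) s -> (k <= output_size s)%N].
  apply/seteqP; split=> w /= h s; first by rewrite -EE => /h[].
  move=> fin; split; first by apply: h; rewrite -EE.
  move=> i j /mem_take il /mem_take jr; apply: ltW.
  have := greedy_clique _ _ _ _ _ fin il jr.
  by rewrite /threshold_graph mxE.
have mS : measurable S.
  pose g w := [ffun ij : 'I_n * 'I_n => `[< e ij.1 ij.2 w >]].
  have gE w : (fun i j => g w (i, j)) = (fun i j => `[< e i j w >]).
    by apply/funext => i; apply/funext => j; rewrite ffunE.
  rewrite (_ : S = [set w | forall s, greedy_final (fun i j => g w (i, j)) s ->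
      (k <= output_size s)%N]).
    exact: (@measurable_finite_pred _ T _ (fun ij : 'I_n * 'I_n => e ij.1 ij.2)
      [set g | forall s, greedy_final (fun i j => g (i, j)) s ->
        (k <= output_size s)%N]).
  by rewrite SE; apply/seteqP; split=> w /= h s; rewrite ?gE => fin; apply: h;
    rewrite ?gE.
apply/andP; split; last exact: probability_le1.
have : (P (~` (A `|` B)) <= P S)%E.
  apply: le_measure; rewrite ?inE//; first exact/measurableC/measurableU.
  move=> w /not_orP[nA nB]; rewrite SE => s fin.
  apply: (greedy_outputs _ _ _ _ _ _ _ fin) => // u v uv.
    by apply: nA; exists u, v.
  by apply: nB; exists u, v.
apply: le_trans; rewrite probability_setC; last exact: measurableU.
rewrite EFinB leeB// mulr2n EFinD (le_trans (measureU2 _ _ _))//.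
exact: leeD.
Qed.

(** * Gaussian tail and numerical estimates *)

(* The density is integrated over [theta, theta + 1] only, with
   sqrt (2 * pi) <= 3 <= expR 2. *)
Lemma normal_tail_ge (R : realType) (theta : R) : 0 <= theta ->
  ((expR (- ((theta + 1) ^+ 2 / 2 + 2)))%:E <=
    normal_prob 0 1 `]theta, +oo[%classic)%E.
Proof.
move=> theta0; pose c : R := expR (- ((theta + 1) ^+ 2 / 2 + 2)).
pose A : set R := `]theta, (theta + 1)[%classic.
have pdf_ge x : A x -> c <= normal_pdf 0 1 x.
  rewrite /A /= in_itv /= => /andP[x1 x2].
  rewrite normal_pdfE ?oner_neq0// /normal_peak /normal_fun expr1n mul1r subr0.
  rewrite /c opprD expRD mulrC; apply: ler_pM; rewrite ?expR_ge0//.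
    rewrite expRN lef_pV2 ?posrE ?expR_gt0 ?sqrtr_gt0//; last first.
      by have := pi_gt0 R; lra.
    apply: (@le_trans _ _ 3); last by apply: le_trans (expR_ge1Dx _); lra.
    rewrite (_ : 3 = Num.sqrt 9); last first.
      by rewrite (_ : 9 = 3 ^+ 2) ?sqrtr_sqr ?ger0_norm//; ring.
    by rewrite ler_wsqrtr//; have := pihalf_lt2 R; lra.
  by rewrite ler_expR; nra.
have mpdf (B : set R) : measurable_fun B (@normal_pdf R 0 1).
  exact: measurable_funS (measurable_normal_pdf 0 1).
apply: (@le_trans _ _ (\int[lebesgue_measure]_(x in A) (normal_pdf 0 1 x)%:E)%E);
  last first.
  apply: ge0_subset_integral => //=.
    exact: measurable_itv.
    by apply/measurable_EFinP; exact: mpdf.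
    by move=> x _; rewrite lee_fin normal_pdf_ge0.
  by move=> x; rewrite /A /= !in_itv /= andbT => /andP[].
apply: (@le_trans _ _ (\int[lebesgue_measure]_(x in A) (cst c%:E x))%E).
  rewrite integral_cst; last exact: measurable_itv.
  have := lebesgue_measure_itv `]theta, (theta + 1)[.
  rewrite /= lte_fin ltrDl ltr01 -EFinB addrAC subrr add0r => A1.
  by rewrite [X in (_ <= _ * X)%E]A1 mule1.
apply: ge0_le_integral => //=.
- exact: measurable_itv.
- by move=> x Ax; rewrite lee_fin expR_ge0.
- by apply/measurable_EFinP; exact: mpdf.
Qed.

(* Here [r = sqrt (k / L)] and [s = sqrt (2 * L / k)], so [r * s = sqrt 2],
   [k <= r * L] and the threshold is [(1 - 9 * r) * s]. *)
Lemma exponent_bound (R : realFieldType) (k L r s : R) :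
  1 <= k -> 81 * k <= L -> 0 <= r -> 0 <= s ->
  r ^+ 2 * L = k -> s ^+ 2 * k = 2 * L ->
  9 * r <= 1 /\ k * (((1 - 9 * r) * s + 1) ^+ 2 / 2 + 2) <= L - 4 * (r * L).
Proof.
move=> k1 kL r0 s0 r2 s2.
have L0 : 0 < L by lra.
have r9 : 9 * r <= 1.
  rewrite -(expr_le1 (n := 2))//; last by lra.
  (* Here [(9 * r) ^+ 2 * L = 81 * k <= L], the source of the constant 81. *)
  rewrite -(ler_pM2r L0) exprMn -mulrA r2; lra.
split=> //.
have rL0 : 0 <= r * L by rewrite mulr_ge0// ltW.
have krL : k <= r * L by rewrite -r2 expr2 -mulrA ler_piMl//; lra.
have ks : k * s <= 3 / 2 * (r * L).
  have rs2 : (r * s) ^+ 2 = 2.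
    by apply: (mulIf (lt0r_neq0 L0)); rewrite exprMn mulrAC r2 mulrC.
  have rs : r * s <= 3 / 2.
    have h : 0 <= 3 / 2 :> R by lra.
    rewrite -(ler_pXn2r (n := 2)) ?nnegrE ?mulr_ge0// rs2; lra.
  have -> : k * s = r * s * (r * L) by rewrite -r2; ring.
  exact: ler_wpM2r.
(* This uses [(1 - 9 * r) ^+ 2 <= 1 - 9 * r], valid since [0 <= 9 * r <= 1]. *)
have sq : k * ((1 - 9 * r) * s) ^+ 2 <= 2 * (L - 9 * (r * L)).
  have -> : k * ((1 - 9 * r) * s) ^+ 2 = (1 - 9 * r) ^+ 2 * (s ^+ 2 * k) by ring.
  have : 0 <= (1 - 9 * r) * (r * L) by rewrite mulr_ge0// subr_ge0.
  by rewrite s2; lra.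
have lin : k * ((1 - 9 * r) * s) <= k * s.
  by rewrite ler_pM2l ?ler_piMl//; lra.
have -> : k * (((1 - 9 * r) * s + 1) ^+ 2 / 2 + 2) =
  k * ((1 - 9 * r) * s) ^+ 2 / 2 + k * ((1 - 9 * r) * s) + 5 / 2 * k by field.
(* With [y = r * L], the three terms are at most [L - 9 * y], [3 / 2 * y] and [5 / 2 * y], with sum
   [L - 5 * y]. *)
lra.
Qed.

(** The number of pairs is [expR (2 * y ^+ 2)] and each fails with probability at most
    [expR (- (3 * y ^+ 2))]. The product is at most [1 / n] because [y ^+ 2 = k * L >= L]. *)
Lemma failure_bound (R : realType) (n k : nat) :
  let L : R := ln n%:R in
  let theta := (1 - 9 * Num.sqrt (k%:R / L)) * Num.sqrt (2 * L / k%:R) in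
  (0 < k)%N -> 6 <= L -> 81 * k%:R <= L ->
  0 <= theta /\
  forall p, expR (- ((theta + 1) ^+ 2 / 2 + 2)) <= p <= 1 ->
    (n ^ (2 * k))%:R * (1 - p ^+ k) ^+ (n - k) <= n%:R^-1.
Proof.
move=> L theta k0 L6 kL.
have kR : 1 <= k%:R :> R by rewrite ler1n.
have n0 : (0 < n)%N.
  (* By convention [ln 0 = 0], so a large [L] excludes [n = 0]. *)
  by rewrite lt0n; apply/eqP => n0; move: L6; rewrite /L n0 ln0//; lra.
have nL : n%:R = expR L by rewrite /L lnK// posrE ltr0n.
pose r := Num.sqrt (k%:R / L); pose s := Num.sqrt (2 * L / k%:R).
have r0 : 0 <= r by exact: sqrtr_ge0.
have s0 : 0 <= s by exact: sqrtr_ge0.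
have r2 : r ^+ 2 * L = k%:R.
  rewrite sqr_sqrtr; last by rewrite divr_ge0//; lra.
  by rewrite divfK//; apply/eqP; lra.
have s2 : s ^+ 2 * k%:R = 2 * L.
  rewrite sqr_sqrtr; last by rewrite divr_ge0//; lra.
  by rewrite divfK//; apply/eqP; lra.
have L0 : 0 < L by lra.
have [r9 exponent] := exponent_bound R k%:R L r s kR kL r0 s0 r2 s2.
have theta_ge0 : 0 <= theta by rewrite mulr_ge0// subr_ge0.
split=> // p /andP[pge p1].
pose y := r * L.
have y2 : y ^+ 2 = k%:R * L by rewrite -r2 /y; ring.
have y0 : 0 <= y by rewrite mulr_ge0//; lra.
have Ly : L <= y ^+ 2 by rewrite y2 ler_peMl// ltW.
have p0 : 0 <= p by exact: le_trans (expR_ge0 _) pge.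
have pk_ge : expR (4 * y - L) <= p ^+ k.
  apply: (@le_trans _ _ (expR (- ((theta + 1) ^+ 2 / 2 + 2)) ^+ k)).
    by rewrite -expRM_natl ler_expR mulrN lerNr opprB.
  by rewrite lerXn2r// nnegrE ?expR_ge0.
have kn : 2 * k%:R <= n%:R :> R.
  by rewrite nL; apply: le_trans (expR_ge1Dx L); lra.
have knN : (k <= n)%N by rewrite -(ler_nat R); lra.
have mean_ge : 3 * y ^+ 2 <= p ^+ k * (n - k)%:R.
  (* From [y <= expR y] comes [y ^+ 4 <= expR (4 * y)], and [y ^+ 2 >= L >= 6]. The factor 6 becomes
     3 below because [n - k >= n / 2]. *)
  have e4 : 6 * y ^+ 2 <= expR (4 * y).
    have : y ^+ 4 <= expR (4 * y).
      rewrite (expRM_natl 4) lerXn2r ?nnegrE ?expR_ge0//.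
      by apply: le_trans (expR_ge1Dx y); lra.
    by apply: le_trans; rewrite (exprM y 2 2) expr2 ler_wpM2r ?sqr_ge0//; lra.
  apply: (@le_trans _ _ (expR (4 * y - L) * (n%:R / 2))).
    by rewrite nL [leRHS]mulrA -expRD subrK; lra.
  apply: ler_pM; rewrite ?expR_ge0 ?divr_ge0//.
  by rewrite natrB//; lra.
(* This is [1 - x <= expR (- x)] with [x = p ^+ k]. *)
have fail_le : (1 - p ^+ k) ^+ (n - k) <= expR (- (3 * y ^+ 2)).
  apply: (@le_trans _ _ (expR (- p ^+ k) ^+ (n - k))).
    by rewrite lerXn2r ?nnegrE ?expR_ge0 ?expR_ge1Dx// subr_ge0 exprn_ile1.
  by rewrite -expRM_natl ler_expR mulrN lerN2 [leRHS]mulrC.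
rewrite natrX nL -expRM_natl natrM -expRN.
apply: (@le_trans _ _ (expR (2 * k%:R * L) * expR (- (3 * y ^+ 2)))).
  by rewrite ler_wpM2l// expR_ge0.
by rewrite -expRD ler_expR -mulrA -y2; lra.
Qed.

(** * Convergence of the success probability *)

Theorem theorem2p2 (R : realType) (k : nat -> nat)
    (k_gt0 : forall n, (0 < k n)%N)
    (k_small : (fun n => (k n)%:R : R^o) =o_\oo (fun n => ln n%:R : R^o)) :
  exists2 theta : nat -> R,
    exists2 eps : nat -> R,
      eps n @[n --> \oo] --> (0 : R) &
      forall n, theta n = (1 + eps n) * Num.sqrt (2 * ln n%:R / (k n)%:R) &
    forall (d : nat -> measure_display) (T : forall n, measurableType (d n))
      (P : forall n, probability (T n) R)
      (C : forall n, 'I_n -> 'I_n -> {RV (P n) >-> R}),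
      (forall n, iid_standard_normal (C n)) ->
      P n [set w | greedy_succeeds (sample_matrix (C n) w) (theta n) (k n)]
        @[n --> \oo] --> 1%E.
Proof.
have ln_ge6 : \forall n \near \oo, 6 <= ln n%:R :> R.
  apply: filterS (nbhs_infty_ger (expR (6 : R))) => n n_ge.
  have n0 : 0 < n%:R :> R by apply: lt_le_trans n_ge; exact: expR_gt0.
  by rewrite -[leLHS](expRK (6 : R)) ler_ln ?posrE ?expR_gt0.
have k_le (e : R) : 0 < e -> \forall n \near \oo, (k n)%:R <= e * ln n%:R.
  move=> e0; have /eqoP/(_ e e0) := k_small.
  apply: filterS2 ln_ge6 => n ln6.
  by rewrite !ger0_norm//; lra.
pose eps n : R := - (9 * Num.sqrt ((k n)%:R / ln n%:R)).
pose theta n : R := (1 + eps n) * Num.sqrt (2 * ln n%:R / (k n)%:R).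
exists theta; first exists eps => //.
  apply/cvgr0Pnorm_lt => e e0.
  (* The choice [k <= (e / 10) ^+ 2 * ln n] gives [9 * sqrt (k / ln n) <= 9 * e / 10 < e]. *)
  have e2 : 0 < (e / 10) ^+ 2 by rewrite exprn_gt0// divr_gt0.
  apply: filterS2 ln_ge6 (k_le _ e2) => n ln6 kn.
  have ln0 : 0 < ln n%:R :> R by lra.
  rewrite /eps normrN ger0_norm ?mulr_ge0//.
  have : Num.sqrt ((k n)%:R / ln n%:R) <= e / 10.
    rewrite -(ger0_norm (x := e / 10)); last by rewrite divr_ge0// ltW.
    by rewrite -sqrtr_sqr ler_wsqrtr// ler_pdivrMr.
  lra.
move=> d T P C iidC.
apply: (@squeeze_cvge _ _ _ _ (fun n => (1 - n%:R^-1 *+ 2)%:E) _ (fun=> 1%E));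
  last exact: cvg_cst.
  have c81 : 0 < 81^-1 :> R by lra.
  apply: filterS2 ln_ge6 (k_le _ c81) => n ln6 kn.
  have n0 : (0 < n)%N.
    by rewrite lt0n; apply/eqP => n0; move: ln6; rewrite n0 ln0//; lra.
  have [normalC indepC] := iidC n.
  (* All entries have the same law, so [p] is the probability of every edge. *)
  pose p := fine (normal_prob 0 1 (`]theta n, +oo[%classic : set R)).
  have Cp i j : P n (C n i j @^-1` `]theta n, +oo[) = p%:E.
    have := normalC i j `]theta n, +oo[%classic (measurable_itv _).
    rewrite /distribution /pushforward => Cij.
    rewrite /p -Cij fineK// fin_num_measure//.
    by apply: measurable_funPTI; exact: measurable_itv.
  have kn81 : 81 * (k n)%:R <= ln n%:R :> R by lra.
  have [theta_ge0 fail_le] := failure_bound R n (k n) (k_gt0 n) ln6 kn81.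
  have p1 : p <= 1.
    have x := Ordinal n0; rewrite -lee_fin -(Cp x x); apply: probability_le1.
    by apply: measurable_funPTI; exact: measurable_itv.
  have p_ge : expR (- ((theta n + 1) ^+ 2 / 2 + 2)) <= p.
    rewrite -lee_fin /p fineK; first exact: normal_tail_ge.
    by rewrite fin_num_measure//; exact: measurable_itv.
  have /andP[lo ->] := greedy_succeeds_prob _ _ _ (P n) n (k n) (C n) (theta n) p
    n0 indepC Cp.
  rewrite andbT; apply: le_trans lo.
  rewrite lee_fin lerD2l lerN2 lerMn2r/=; apply: fail_le.
  by rewrite p1 andbT.
rewrite -[X in _ --> X]/(1%:E); apply: cvg_EFin; first exact: nearW.
rewrite /comp /= -[X in _ --> X](subr0 1) -(mul0rn _ 2).
apply: cvgB; first exact: cvg_cst.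
have inv0 : (n%:R : R)^-1 @[n --> \oo] --> 0.
  by apply/gtr0_cvgV0; [exact: nbhs_infty_gtr | exact: cvgr_idn].
by rewrite mul0rn -(addr0 0); exact: cvgD.
Qed.
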